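(* Consider the falling rod with parameters $\rho>0$ and $0<\gamma<1$ and initial generalized velocity $\vec p^{(0)}=[\omega^{(0)}\ \ v^{(0)}]^T\in\mathbb R^2$. The rod undergoes complete chatter (CC) if and only if $$\rho\le \frac{2}{\sqrt{\gamma}+1}-1$$ is satisfied and $\vec p^{(0)}\in\mathcal K$, where $\mathcal K$ is the cone spanned by the two vectors $\vec p_{min}$ and $\vec P\vec p_{min}$.
   Context: Rod model (planar, linearized kinematics, no friction, no gravity or other external forces). A rigid rod with symmetric mass distribution has two potential contact points (its endpoints) at local coordinates $x_0=1$, $x_1=-1$; it has mass $m>0$ and radius of gyration $\rho>0$. Its generalized coordinates are $\vec q=[\phi\ \ h]^T$ (small rotation angle and height of the centre of mass) and its generalized velocity is $\vec p=\dot{\vec q}=[\omega\ \ v]^T$. With $\vec f_i=[x_i\ \ 1]^T$, endpoint $i\in\{0,1\}$ has height $h_i=\vec f_i^T\vec q$ and normal velocity $v_i=\vec f_i^T\vec p$ above the ground. The admissible configurations are those with $h_0,h_1\ge 0$. Between impacts $\vec p$ is constant. An impact occurs at endpoint $i$ when $h_i=0$ and $v_i<0$; then $\vec q$ is unchanged and $\vec p$ is replaced by $\vec U_i\vec p$, where $$\vec U_i=\vec I-\frac{1+\gamma}{\vec f_i^T\vec\Theta^{-1}\vec f_i}\,\vec\Theta^{-1}\vec f_i\vec f_i^T,\qquad \vec\Theta=m\begin{bmatrix}\rho^2&0\\0&1\end{bmatrix},$$ and $\gamma\in(0,1)$ is the coefficient of restitution. The motion considered starts before the first collision, with generalized velocity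 $\vec p^{(0)}$; the first collision occurs at one of the two endpoints (simultaneous collisions of both endpoints are not modelled). Complete chatter (CC): the rod undergoes an infinite sequence of collisions in finite time, after which its velocity relative to the surface becomes zero. (The alternative, incomplete chatter, is that the rod leaves the surface with finite velocity after a finite number of collisions.) Let $\vec P=\begin{bmatrix}-1&0\\0&1\end{bmatrix}$, so that $$\vec U_0\vec P=\begin{bmatrix}\frac{\gamma+1}{\rho^2+1}-1&-\frac{\gamma+1}{\rho^2+1}\\ \rho^2\frac{\gamma+1}{\rho^2+1}&\frac{\gamma+1}{\rho^2+1}-\gamma\end{bmatrix}.$$ When $\rho\le \frac{2}{\sqrt\gamma+1}-1$, the eigenvalues of $\vec U_0\vec P$ are real and positive, $\lambda_{max}\ge\lambda_{min}>0$, and $\vec p_{min}$ denotes the eigenvector belonging to $\lambda_{min}$ whose second coordinate is $-1$, namely $$\vec p_{min}=\left(\frac{(1-\gamma)(\rho^2+1)+\sigma^{1/2}}{2\rho^2(\gamma+1)},\,-1\right)^T,\qquad \sigma=(1-\rho^2)^2(1+\gamma)^2-4\gamma(1+\rho^2)^2 .$$ The cone spanned (generated) by a set of vectors is the set of their linear combinations with nonnegative coefficients.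
   Formalization: On the two edge rays of K the rod collides infinitely often but not in finite time, so CC fails there; the formal theorem proves CC iff the bound on rho holds and p^(0) lies in K minus its edge rays, and keeps closed K for chatter without the finite-time requirement. *)

(* Defs.v *)
From HB Require Import structures.
From mathcomp Require Import all_boot all_order all_algebra.
From mathcomp Require Import all_classical all_reals all_analysis.

Set Implicit Arguments.
Unset Strict Implicit.
Unset Printing Implicit Defensive.

Import Order.TTheory GRing.Theory Num.Theory.
Import numFieldNormedType.Exports.
Local Open Scope classical_set_scope.
Local Open Scope ring_scope.

Section Rod.
Variable R : realType.

(* Generalized coordinates are [phi; h], generalized velocities [omega; v]. *)
Definition vec2 (a b : R) : 'cV[R]_2 := \col_(j < 2) [:: a; b]`_j.

Definition contact (i : 'I_2) : 'cV[R]_2 := vec2 (if i == 0 then 1 else -1) 1.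

(* f_i^T w: the height of endpoint i when w is a configuration, its normal
   velocity when w is a generalized velocity. *)
Definition normal (i : 'I_2) (w : 'cV[R]_2) : R := ((contact i)^T *m w) 0 0.

Definition Theta (m rho : R) : 'M[R]_2 :=
  m *: diag_mx (\row_(j < 2) [:: rho ^+ 2; 1]`_j).

Definition U (m rho gamma : R) (i : 'I_2) : 'M[R]_2 :=
  let f := contact i in
  let W := invmx (Theta m rho) in
  1%:M - ((1 + gamma) / (f^T *m W *m f) 0 0) *: (W *m f *m f^T).

Record state := State { time : R ; conf : 'cV[R]_2 ; vel : 'cV[R]_2 }.

Definition admissible (q : 'cV[R]_2) : Prop := forall i, 0 <= normal i q.

Definition impacting (i : 'I_2) (q p : 'cV[R]_2) : Prop :=
  normal i q = 0 /\ normal i p < 0.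

(* Free flight from s up to the next collision, which takes place at endpoint i
   and leaves the rod in the state s'.  Admissibility during the flight makes
   this the first collision after s: past a time at which some endpoint is
   impacting, unchanged velocity would carry it below the surface.  There is no
   transition out of a simultaneous collision of both endpoints. *)
Definition collision (m rho gamma : R) (s : state) (i : 'I_2) (s' : state) :
    Prop :=
  let tau := time s' - time s in
  [/\ 0 <= tau,
      forall u, 0 <= u <= tau -> admissible (conf s + u *: vel s),
      conf s' = conf s + tau *: vel s,
      impacting i (conf s') (vel s) /\
        (forall j, j != i -> ~ impacting j (conf s') (vel s)) &
      vel s' = U m rho gamma i *m vel s].

Definition before_first_collision (m rho gamma : R) (q0 p0 : 'cV[R]_2) : Prop :=
  exists (i : 'I_2) (s1 : state),
    0 < time s1 /\ collision m rho gamma (State 0 q0 p0) i s1.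

(* s 0 is the initial state, s k.+1 the state just after the (k+1)-st
   collision. *)
Definition collision_sequence (m rho gamma : R) (q0 p0 : 'cV[R]_2)
    (s : nat -> state) : Prop :=
  s 0%N = State 0 q0 p0 /\
  forall k, exists i, collision m rho gamma (s k) i (s k.+1).

Definition vanishing_velocity (s : nat -> state) : Prop :=
  (fun k => vel (s k)) @ \oo --> (0 : 'cV[R]_2).

Definition complete_chatter (m rho gamma : R) (q0 p0 : 'cV[R]_2) : Prop :=
  exists s, [/\ collision_sequence m rho gamma q0 p0 s,
                exists T, forall k, time (s k) <= T &
                vanishing_velocity s].

(* Complete chatter without the requirement that the collision times be
   bounded.  The two differ on the edges of K: there the motion follows the
   eigenvector p_min, the time between consecutive collisions is multiplied by
   gamma / lambda_min^2 = lambda_max / lambda_min >= 1 at each step, and the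
   infinitely many collisions take infinite time. *)
Definition endless_chatter (m rho gamma : R) (q0 p0 : 'cV[R]_2) : Prop :=
  exists s, collision_sequence m rho gamma q0 p0 s /\ vanishing_velocity s.

Definition P : 'M[R]_2 := diag_mx (\row_(j < 2) [:: -1; 1]`_j).

Definition sigma (rho gamma : R) : R :=
  (1 - rho ^+ 2) ^+ 2 * (1 + gamma) ^+ 2
  - 4 * gamma * (1 + rho ^+ 2) ^+ 2.

(* The eigenvector of U_0 P for its smaller eigenvalue, meaningful only when
   rho <= 2 / (sqrt gamma + 1) - 1; otherwise Num.sqrt may be applied to a
   negative number, on which it returns 0. *)
Definition p_min (rho gamma : R) : 'cV[R]_2 :=
  vec2 (((1 - gamma) * (rho ^+ 2 + 1) + Num.sqrt (sigma rho gamma))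
          / (2 * rho ^+ 2 * (gamma + 1))) (-1).

Definition cone (vs : seq 'cV[R]_2) : set 'cV[R]_2 :=
  [set w | exists c : 'I_(size vs) -> R,
     (forall i, 0 <= c i) /\ w = \sum_(i < size vs) c i *: vs`_i].

Definition K (rho gamma : R) : set 'cV[R]_2 :=
  cone [:: p_min rho gamma; P *m p_min rho gamma].

Definition K_edges (rho gamma : R) : set 'cV[R]_2 :=
  cone [:: p_min rho gamma] `|` cone [:: P *m p_min rho gamma].

End Rod.

(* Main.v *)
(* Write v_i for the normal velocity of endpoint i.  A collision at endpoint i
   maps v_i to -gamma v_i and adds kappa v_i to the other normal velocity, where
   kappa = (1+gamma)(1-rho^2)/(1+rho^2).  The endpoint that has just bounced
   moves upwards, so collisions alternate between the endpoints, and the impact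
   speeds satisfy a_(k+2) = kappa a_(k+1) - gamma a_k.  Collisions go on forever
   iff all a_k are positive.  This forces real positive characteristic roots
   mu <= lam (the condition on rho) and mu a_0 <= a_1, which describes the cone K
   because p_min = ((1+lam)/(1-lam), -1); equality holds on the edges.
   Both roots are less than 1, so the velocity then vanishes.  The k-th flight
   time is proportional to gamma^k/(a_k a_(k+1)), whose sum telescopes to a
   bounded quantity if mu a_0 < a_1; if mu a_0 = a_1 the flight times do not
   decrease. *)
Require Import Defs.
From mathcomp Require Import all_boot all_order all_algebra.
From mathcomp Require Import all_classical all_reals all_analysis.
From mathcomp Require Import ring lra.
Import Order.TTheory GRing.Theory Num.Theory.
Import numFieldNormedType.Exports.
Local Open Scope classical_set_scope.
Local Open Scope ring_scope.

(** * Normal components as coordinates *)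

Lemma ord2_ind (Q : 'I_2 -> Prop) : Q 0 -> Q 1 -> forall i, Q i.
Proof.
move=> Q0 Q1 [[|[|//]] lti].
- by rewrite (_ : Ordinal lti = 0) //; exact: val_inj.
- by rewrite (_ : Ordinal lti = 1) //; exact: val_inj.
Qed.

Lemma rev_ord2_0 : rev_ord 0 = 1 :> 'I_2.
Proof. exact: val_inj. Qed.

Lemma rev_ord2_1 : rev_ord 1 = 0 :> 'I_2.
Proof. exact: val_inj. Qed.

Lemma ord2_eq_rev (i j : 'I_2) : j != i -> j = rev_ord i.
Proof.
by elim/ord2_ind: i; elim/ord2_ind: j; rewrite ?rev_ord2_0 ?rev_ord2_1.
Qed.

Lemma normalE {R : realType} (i : 'I_2) (w : 'cV[R]_2) :
  normal i w = (if i == 0 then 1 else -1) * w 0 0 + w 1 0.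
Proof.
rewrite /normal mxE !big_ord_recl big_ord0 !mxE /=.
rewrite (_ : lift ord0 ord0 = 1) ?mul1r ?addr0 //; exact: val_inj.
Qed.

Lemma normal0 {R : realType} (w : 'cV[R]_2) : normal 0 w = w 0 0 + w 1 0.
Proof. by rewrite normalE mul1r. Qed.

Lemma normal1 {R : realType} (w : 'cV[R]_2) : normal 1 w = - w 0 0 + w 1 0.
Proof. by rewrite normalE mulN1r. Qed.

Lemma normalD {R : realType} i (u w : 'cV[R]_2) :
  normal i (u + w) = normal i u + normal i w.
Proof. by rewrite !normalE !mxE; ring. Qed.

Lemma normalZ {R : realType} i c (w : 'cV[R]_2) :
  normal i (c *: w) = c * normal i w.
Proof. by rewrite !normalE !mxE; ring. Qed.

Lemma normal_inj {R : realType} (u w : 'cV[R]_2) :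
  normal 0 u = normal 0 w -> normal 1 u = normal 1 w -> u = w.
Proof.
rewrite !normal0 !normal1 => e0 e1; apply/colP.
by elim/ord2_ind; lra.
Qed.

Lemma normal_inj_rev {R : realType} i (u w : 'cV[R]_2) :
  normal i u = normal i w -> normal (rev_ord i) u = normal (rev_ord i) w ->
  u = w.
Proof.
by elim/ord2_ind: i; rewrite ?rev_ord2_0 ?rev_ord2_1 => *; exact: normal_inj.
Qed.

Lemma normal_vec2 {R : realType} i (a b : R) :
  normal i (vec2 a b) = (if i == 0 then a else - a) + b.
Proof. by rewrite normalE !mxE /=; case: ifP => _; ring. Qed.

Lemma normal_P {R : realType} i (w : 'cV[R]_2) :
  normal i (P R *m w) = normal (rev_ord i) w.
Proof.
elim/ord2_ind: i; rewrite ?rev_ord2_0 ?rev_ord2_1 !(normal0, normal1) /P;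
  rewrite mul_diag_mx !mxE /=; ring.
Qed.

(** * Effect of an impact on the normal velocities *)

Definition kappa {R : realType} (rho gamma : R) : R :=
  (1 + gamma) * (1 - rho ^+ 2) / (1 + rho ^+ 2).

Lemma invmx_Theta {R : realType} (m rho : R) : 0 < m -> 0 < rho ->
  invmx (Theta m rho) =
    diag_mx (\row_(j < 2) [:: (m * rho ^+ 2)^-1; m^-1]`_j).
Proof.
move=> /lt0r_neq0 m0 /lt0r_neq0 r0; set V := diag_mx _.
have TV : Theta m rho *m V = 1%:M.
  rewrite /Theta /V -scalemxAl mulmx_diag; apply/matrixP.
  elim/ord2_ind; elim/ord2_ind; rewrite !mxE /= ?mulr0n ?mulr1n ?mulr0 //.
    by field; rewrite m0 r0.
  by field.
have [Tu _] := mulmx1_unit TV.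
by rewrite -[RHS](mulKmx Tu) TV mulmx1.
Qed.

Lemma mul_UE {R : realType} (m rho gamma : R) i (p : 'cV[R]_2) :
  0 < m -> 0 < rho ->
  U m rho gamma i *m p = p - ((1 + gamma) * normal i p / (1 + rho ^+ 2)) *:
    vec2 (if i == 0 then 1 else -1) (rho ^+ 2).
Proof.
move=> m_gt0 r_gt0.
have m0 : m != 0 by rewrite gt_eqF.
have r0 : rho != 0 by rewrite gt_eqF.
have d0 : 1 + rho ^+ 2 != 0 by rewrite gt_eqF // ltr_wpDr ?sqr_ge0.
rewrite /U invmx_Theta // -mulmxA.
(* The mass is isolated in a scalar factor, which cancels against the denominator in [U]. *)
have -> : diag_mx (\row_(j < 2) [:: (m * rho ^+ 2)^-1; m^-1]`_j)
    *m contact R i = (m * rho ^+ 2)^-1 *: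
      vec2 (if i == 0 then 1 else -1) (rho ^+ 2).
  apply/colP; elim/ord2_ind; rewrite mul_diag_mx !mxE //=.
  by field; rewrite m0 r0.
rewrite -[(_ *m (_ *: _)) 0 0]/(normal i _) normalZ normal_vec2.
rewrite mulmxBl mul1mx -!scalemxAl scalerA -mulmxA.
have -> : (contact R i)^T *m p = (normal i p)%:M by rewrite {1}[LHS]mx11_scalar.
rewrite mul_mx_scalar scalerA; congr (_ - _ *: _).
by case: (i == 0) => /=; field; rewrite m0 r0 ?opprK d0.
Qed.

Lemma normal_U {R : realType} (m rho gamma : R) i (p : 'cV[R]_2) :
  0 < m -> 0 < rho ->
  normal i (U m rho gamma i *m p) = - gamma * normal i p.
Proof.
move=> m_gt0 r_gt0; rewrite mul_UE // normalD -scaleNr normalZ normal_vec2.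
have d0 : 1 + rho ^+ 2 != 0 by rewrite gt_eqF // ltr_wpDr ?sqr_ge0.
by case: (i == 0) => /=; field.
Qed.

Lemma normal_rev_U {R : realType} (m rho gamma : R) i (p : 'cV[R]_2) :
  0 < m -> 0 < rho ->
  normal (rev_ord i) (U m rho gamma i *m p) =
  normal (rev_ord i) p + kappa rho gamma * normal i p.
Proof.
move=> m_gt0 r_gt0; rewrite mul_UE // normalD -scaleNr normalZ normal_vec2.
rewrite /kappa.
have d0 : 1 + rho ^+ 2 != 0 by rewrite gt_eqF // ltr_wpDr ?sqr_ge0.
by elim/ord2_ind: i; rewrite ?rev_ord2_0 ?rev_ord2_1 /=; field.
Qed.

(** * Positive solutions of second-order linear recurrences *)

(* The successive ratios of a positive solution would decrease by a fixed
   amount at each step if the characteristic polynomial had no real root. *)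
Lemma rec2_pos_discr {R : archiRealFieldType} (kap g : R) (a : nat -> R) :
  0 < g -> (forall k, a k.+2 = kap * a k.+1 - g * a k) ->
  (forall k, 0 < a k) -> 0 < kap /\ 4 * g <= kap ^+ 2.
Proof.
move=> g0 rec a0.
have kap0 : 0 < kap.
  have := a0 2%N; rewrite rec => h.
  have : 0 < kap * a 1%N by have := mulr_gt0 g0 (a0 0%N); lra.
  by rewrite pmulr_lgt0.
split=> //; rewrite leNgt; apply/negP => disc.
pose r k := a k.+2 / a k.+1.
(* The decrease of the ratio is [(r ^+ 2 - kap * r + g) / r]. Completing the square bounds its
   numerator below by [g - kap ^+ 2 / 4], and [r < kap] bounds its denominator. *)
pose e := (g - kap ^+ 2 / 4) / kap.
have e0 : 0 < e by rewrite divr_gt0 //; lra.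
have r0 k : 0 < r k by rewrite divr_gt0.
have rS k : r k.+1 = kap - g / r k.
  by rewrite /r rec; field; rewrite !lt0r_neq0.
have rlt k : r k < kap.
  by rewrite /r ltr_pdivrMr // rec; have := mulr_gt0 g0 (a0 k); lra.
have step k : r k.+1 <= r k - e.
  have rk := r0 k; have rkn := lt0r_neq0 rk; have kn := lt0r_neq0 kap0.
  have -> : r k.+1 = r k - ((r k - kap / 2) ^+ 2 + (g - kap ^+ 2 / 4)) / r k.
    by rewrite rS; field.
  rewrite lerD2l lerN2.
  apply: (@le_trans _ _ ((g - kap ^+ 2 / 4) / r k)).
    by rewrite /e ler_pM2l ?lef_pV2 ?posrE ?ltW //; lra.
  by rewrite ler_pM2r ?invr_gt0 // lerDr sqr_ge0.
have bound k : r k <= r 0%N - k%:R * e.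
  elim: k => [|k IH]; first by rewrite mul0r subr0.
  by have := step k; rewrite -natr1; lra.
have /archi_boundP : 0 <= r 0%N / e by rewrite divr_ge0 // ltW.
rewrite ltr_pdivrMr // => h.
have := r0 (Num.bound (r 0%N / e)).
by have := bound (Num.bound (r 0%N / e)); lra.
Qed.

(** Splitting off one root [mu] of the characteristic polynomial leaves a first-order recurrence of
    ratio [lam]. *)
Lemma rec2_gap {R : comRingType} (lam mu : R) (a : nat -> R) :
  (forall k, a k.+2 = (lam + mu) * a k.+1 - lam * mu * a k) ->
  forall k, a k.+1 - mu * a k = lam ^+ k * (a 1%N - mu * a 0%N).
Proof.
move=> rec; elim=> [|k IH]; first by rewrite mul1r.
by rewrite exprS -mulrA -IH rec; ring.
Qed.

(** If the initial gap [d] were negative, [a k / mu ^+ k] would drop by at least [- d / mu] at each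
    step, because [lam ^+ k >= mu ^+ k]. This argument includes the double root. *)
Lemma rec2_pos_gap_ge0 {R : archiRealFieldType} (lam mu : R) (a : nat -> R) :
  0 < mu <= lam ->
  (forall k, a k.+2 = (lam + mu) * a k.+1 - lam * mu * a k) ->
  (forall k, 0 < a k) -> mu * a 0%N <= a 1%N.
Proof.
move=> /andP[mu0 le_mulam] /rec2_gap gap a0.
rewrite -subr_ge0 leNgt; apply/negP; set d := _ - _ => d0.
have bound k : a k <= mu ^+ k * (a 0%N + k%:R * (d / mu)).
  elim: k => [|k IH]; first by rewrite mul0r addr0 mul1r.
  have -> : a k.+1 = mu * a k + lam ^+ k * d by rewrite /d -gap; ring.
  have -> : mu ^+ k.+1 * (a 0%N + k.+1%:R * (d / mu)) =
      mu * (mu ^+ k * (a 0%N + k%:R * (d / mu))) + mu ^+ k * d.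
    by rewrite exprS -natr1; field; rewrite lt0r_neq0.
  apply: lerD; first by rewrite ler_pM2l.
  by rewrite ler_nM2r // lerXn2r // nnegrE ltW // (lt_le_trans mu0).
have c0 : 0 < - (d / mu) by rewrite -mulNr divr_gt0 // oppr_gt0.
have /archi_boundP : 0 <= a 0%N / - (d / mu) by rewrite divr_ge0 // ltW.
set n := Num.bound _; rewrite ltr_pdivrMr // => h.
have := lt_le_trans (a0 n) (bound n).
by rewrite pmulr_rgt0 ?exprn_gt0 //; lra.
Qed.

Lemma rec2_pos {R : realFieldType} (lam mu : R) (a : nat -> R) :
  0 < lam -> 0 < mu ->
  (forall k, a k.+2 = (lam + mu) * a k.+1 - lam * mu * a k) ->
  0 < a 0%N -> mu * a 0%N <= a 1%N -> forall k, 0 < a k.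
Proof.
move=> lam0 mu0 /rec2_gap gap a0 a1; elim=> [//|k IH].
apply: (lt_le_trans (mulr_gt0 mu0 IH)).
by rewrite -subr_ge0 gap mulr_ge0 ?subr_ge0 // exprn_ge0 // ltW.
Qed.

Lemma rec2_cvg0 {R : realType} (lam mu : R) (a : nat -> R) :
  0 < lam < 1 -> 0 < mu <= lam ->
  (forall k, a k.+2 = (lam + mu) * a k.+1 - lam * mu * a k) ->
  a @ \oo --> 0.
Proof.
move=> /andP[lam0 lam1] /andP[mu0 le_mulam] /rec2_gap gap.
(* At a double root [a k] can behave like [k * lam ^+ k], hence a ratio [r] strictly above [lam].
   The constant [M] satisfies [(r - lam) * M >= |d|], which closes the induction. *)
pose d := a 1%N - mu * a 0%N; pose r := (1 + lam) / 2.
have [r0 r1 lt_lamr] : [/\ 0 < r, r < 1 & lam < r] by rewrite /r; split; lra.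
pose M := `|a 0%N| + `|d| / (r - lam).
have M0 : 0 <= `|d| / (r - lam) by rewrite divr_ge0 // subr_ge0 ltW.
have bound k : `|a k| <= M * r ^+ k.
  elim: k => [|k IH]; first by rewrite mulr1 lerDl.
  have -> : a k.+1 = mu * a k + lam ^+ k * d by rewrite /d -gap; ring.
  rewrite (le_trans (ler_normD _ _)) // !normrM normrX.
  rewrite (gtr0_norm mu0) (gtr0_norm lam0).
  have h1 : mu * `|a k| <= lam * (M * r ^+ k).
    by rewrite ler_pM // ltW.
  have h2 : lam ^+ k * `|d| <= r ^+ k * ((r - lam) * M).
    rewrite ler_pM ?exprn_ge0 ?(ltW lam0) //.
      by rewrite lerXn2r ?nnegrE // ltW.
    rewrite /M mulrDr mulrCA divff ?mulr1 ?subr_eq0 ?gt_eqF // lerDr.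
    by rewrite mulr_ge0 // subr_ge0 ltW.
  apply: le_trans (lerD h1 h2) _; rewrite le_eqVlt; apply/orP; left; apply/eqP.
  by rewrite exprS; ring.
apply: norm_cvg0; apply: (@squeeze_cvgr _ _ _ _ (cst 0) (geometric M r)).
- by near=> k; rewrite normr_ge0 bound.
- exact: cvg_cst.
- by apply: cvg_geometric; rewrite gtr0_norm.
Unshelve. all: by end_near. Qed.

(** * Flight times *)

(** During one flight an endpoint falls from height [h k] at speed [a k.+1] while the other rises to
    [h k.+1] at speed [g * a k]. Eliminating the flight time multiplies [a k * h k] by [g]. *)
Lemma flight_heights {R : realFieldType} (g : R) (a h t : nat -> R) :
  (forall k, 0 < a k) ->
  (forall k, a k.+1 * (t k.+1 - t k) = h k) ->
  (forall k, h k.+1 = g * a k * (t k.+1 - t k)) ->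
  forall k, a k * h k = g ^+ k * (a 0%N * h 0%N).
Proof.
move=> a0 th hS; elim=> [|k IH]; first by rewrite mul1r.
by rewrite exprS -[RHS]mulrA -IH -(th k) hS; ring.
Qed.

(* [h k] is the height of the free endpoint at collision [k]; the sum of the
   flight times telescopes, because the Casoratian of [a] and [mu ^+ k] is a
   geometric sequence of ratio [lam * mu]. *)
Lemma flight_times_sum {R : realFieldType} (lam mu : R) (a h t : nat -> R) :
  (forall k, 0 < a k) ->
  (forall k, a k.+2 = (lam + mu) * a k.+1 - lam * mu * a k) ->
  (forall k, a k.+1 * (t k.+1 - t k) = h k) ->
  (forall k, h k.+1 = lam * mu * a k * (t k.+1 - t k)) ->
  a 1%N - mu * a 0%N != 0 ->
  forall k, t k = t 0%N + h 0%N / (a 1%N - mu * a 0%N) *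
                          (1 - mu ^+ k * a 0%N / a k).
Proof.
move=> a0 rec th hS d0.
have := rec2_gap _ _ _ rec => gap.
have heights := flight_heights _ _ _ _ a0 th hS.
elim=> [|k IH].
  by rewrite mul1r divff ?subrr ?mulr0 ?addr0 ?lt0r_neq0.
have [an an1 a0n] : [/\ a k != 0, a k.+1 != 0 & a 0%N != 0].
  by split; rewrite lt0r_neq0.
have -> : t k.+1 = t k + h k / a k.+1 by rewrite -th; field.
have -> : h k = (lam * mu) ^+ k * (a 0%N * h 0%N) / a k.
  by rewrite -heights; field.
rewrite IH exprMn exprS -addrA; congr (_ + _).
(* With this value of [lam ^+ k] the flight time becomes a multiple of
   [mu ^+ k / a k - mu ^+ k.+1 / a k.+1]. *)
have -> : (lam ^+ k) = (a k.+1 - mu * a k) / (a 1%N - mu * a 0%N).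
  by rewrite gap mulfK.
field; by rewrite an an1 d0.


Qed.

Lemma flight_times_bounded {R : realFieldType} (lam mu : R) (a h t : nat -> R) :
  0 < mu -> (forall k, 0 < a k) ->
  (forall k, a k.+2 = (lam + mu) * a k.+1 - lam * mu * a k) ->
  (forall k, a k.+1 * (t k.+1 - t k) = h k) ->
  (forall k, h k.+1 = lam * mu * a k * (t k.+1 - t k)) ->
  0 <= h 0%N -> mu * a 0%N < a 1%N ->
  forall k, t k <= t 0%N + h 0%N / (a 1%N - mu * a 0%N).
Proof.
move=> mu0 a0 rec th hS h0; rewrite -subr_gt0 => d0 k.
rewrite (flight_times_sum _ _ _ _ _ a0 rec th hS (lt0r_neq0 d0)).
rewrite lerD2l ler_piMr //; first by rewrite divr_ge0 // ltW.
by rewrite gerDl oppr_le0 divr_ge0 ?mulr_ge0 ?exprn_ge0 ?ltW.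
Qed.

(** Here [a] is geometric of ratio [mu] and [h] of ratio [lam], so the flight times have ratio
    [lam / mu >= 1] and never fall below the first one, [c]. *)
Lemma flight_times_unbounded {R : archiRealFieldType} (lam mu : R)
    (a h t : nat -> R) :
  0 < mu <= lam -> (forall k, 0 < a k) ->
  (forall k, a k.+2 = (lam + mu) * a k.+1 - lam * mu * a k) ->
  (forall k, a k.+1 * (t k.+1 - t k) = h k) ->
  (forall k, h k.+1 = lam * mu * a k * (t k.+1 - t k)) ->
  0 < h 0%N -> a 1%N = mu * a 0%N -> ~ exists T, forall k, t k <= T.
Proof.
move=> /andP[mu0 le_mulam] a0 rec th hS h0 d0 [T bound].
have heights := flight_heights _ _ _ _ a0 th hS.
have aS k : a k.+1 = mu * a k.
  apply/eqP; rewrite -subr_eq0 (rec2_gap _ _ _ rec) d0 subrr mulr0 //.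
have aE k : a k = mu ^+ k * a 0%N.
  elim: k => [|k IH]; first by rewrite mul1r.
  by rewrite aS IH exprS mulrA.
have hE k : h k = lam ^+ k * h 0%N.
  apply: (mulfI (lt0r_neq0 (a0 k))).
  by rewrite heights (aE k) exprMn; ring.
pose c := h 0%N / a 1%N; have c0 : 0 < c by rewrite divr_gt0.
have step k : c <= t k.+1 - t k.
  rewrite -(ler_pM2l (a0 k.+1)) th hE.
  have -> : a k.+1 * c = mu ^+ k * h 0%N.
    by rewrite /c d0 aE exprS; field; rewrite !lt0r_neq0.
  by rewrite ler_pM2r // lerXn2r // nnegrE ltW // (lt_le_trans mu0).
have lower k : t 0%N + k%:R * c <= t k.
  elim: k => [|k IH]; first by rewrite mul0r addr0.
  by have := step k; rewrite -natr1; lra.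
have := le_lt_trans (ler_norm _)
  (archi_boundP (normr_ge0 ((T - t 0%N) / c))); set n := Num.bound _.
rewrite ltr_pdivrMr // => hn.
by have := bound n; have := lower n; lra.
Qed.

(** * The trajectory and its impact speeds *)

Definition next {R : realType} (m rho gamma : R) (i : 'I_2) (s : state R) :
    state R :=
  let tau := - normal i (conf s) / normal i (vel s) in
  State (time s + tau) (conf s + tau *: vel s) (U m rho gamma i *m vel s).

Lemma collision_speed {R : realType} (m rho gamma : R) s i s' :
  collision m rho gamma s i s' -> normal i (vel s) < 0.
Proof. by case=> _ _ _ [[_ ?] _] _. Qed.

Lemma collision_normal0 {R : realType} (m rho gamma : R) s i s' :
  collision m rho gamma s i s' ->
  normal i (conf s) + (time s' - time s) * normal i (vel s) = 0.
Proof. by case=> _ _ -> [[]]; rewrite normalD normalZ. Qed.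

Lemma collision_next {R : realType} (m rho gamma : R) s i s' :
  collision m rho gamma s i s' -> s' = next m rho gamma i s.
Proof.
move=> c; have v0 := collision_speed _ _ _ _ _ _ c.
have c0 := collision_normal0 _ _ _ _ _ _ c.
have tauE : - normal i (conf s) / normal i (vel s) = time s' - time s.
  by apply: (canLR (mulfK _)); [rewrite lt_eqF | lra].
rewrite /next tauE; case: c => _ _ <- _ <-.
by rewrite addrC subrK; case: s' {v0 c0 tauE}.
Qed.

(** A flight lasting beyond the time of [s'] would carry endpoint [i] below the ground, against
    admissibility. *)
Lemma collision_time_le {R : realType} (m rho gamma : R) s i j s' s'' :
  collision m rho gamma s i s' -> collision m rho gamma s j s'' ->
  time s'' <= time s'.
Proof.
move=> ci cj; have v0 := collision_speed _ _ _ _ _ _ ci.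
have c0 := collision_normal0 _ _ _ _ _ _ ci.
case: cj => tau0 adm _ _ _.
have := adm (time s'' - time s); rewrite lexx tau0 => /(_ isT i).
rewrite normalD normalZ; rewrite leNgt; apply: contraNle => lt_s.
have : (time s'' - time s') * normal i (vel s) < 0.
  by rewrite pmulr_rlt0 // subr_gt0.
lra.
Qed.

(** Both collisions happen at the same time, hence in the same configuration, and simultaneous
    impacts of both endpoints are excluded. *)
Lemma collision_uniq {R : realType} (m rho gamma : R) s i j s' s'' :
  collision m rho gamma s i s' -> collision m rho gamma s j s'' -> i = j.
Proof.
move=> ci cj.
have tE : time s' = time s''.
  by apply: le_anti; rewrite (collision_time_le _ _ _ _ _ _ _ _ cj ci)
    (collision_time_le _ _ _ _ _ _ _ _ ci cj).
apply/eqP/negP => /negP ne.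
case: ci => _ _ qE [_ other] _; case: cj => _ _ qE' [imp _] _.
by case: (other j); rewrite 1?eq_sym // qE tE -qE'.
Qed.

(* The free endpoint may already touch the ground, hence the weak inequality on
   its height; it is lifting off, so that it is not impacting. *)
Lemma next_collision {R : realType} (m rho gamma : R) s i :
  0 <= normal i (conf s) -> normal i (vel s) < 0 ->
  0 <= normal (rev_ord i) (conf s) -> 0 < normal (rev_ord i) (vel s) ->
  collision m rho gamma s i (next m rho gamma i s).
Proof.
move=> hi vi hj vj; rewrite /next /collision /=.
set tau := _ / _; rewrite addrAC subrr add0r.
have tau0 : 0 <= tau.
  by rewrite /tau mulNr -mulrN -invrN divr_ge0 // oppr_ge0 ltW.
have hit : normal i (conf s) + tau * normal i (vel s) = 0.
  by rewrite /tau divfK ?subrr // lt_eqF.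
split=> //.
- move=> u /andP[u0 ut] j; rewrite normalD normalZ.
  have [->|/ord2_eq_rev->] := eqVneq j i.
    rewrite -hit lerD2l ler_wnM2r // ltW //.
  by rewrite addr_ge0 // mulr_ge0 // ltW.
- split; first by split; rewrite // normalD normalZ.
  by move=> j /ord2_eq_rev-> [_]; rewrite ltNge ltW.
Qed.

Definition side (i : 'I_2) (k : nat) : 'I_2 := iter k (@rev_ord 2) i.

(** The only candidate for a trajectory whose first collision is at [i]. It is defined whether or
    not its collisions really occur, so that its impact speeds can be studied beforehand. *)
Fixpoint run {R : realType} (m rho gamma : R) (i : 'I_2) (s : state R)
    (k : nat) : state R :=
  if k is k'.+1 then next m rho gamma (side i k') (run m rho gamma i s k')
  else s.

(** The endpoint just hit moves upwards and cannot be the next to collide, which forces the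
    alternation. *)
Lemma collision_sequence_run {R : realType} (m rho gamma : R) q0 p0 i s :
  0 < m -> 0 < rho -> 0 < gamma ->
  collision_sequence m rho gamma q0 p0 s ->
  collision m rho gamma (s 0%N) i (s 1%N) ->
  forall k, collision m rho gamma (s k) (side i k) (s k.+1) /\
    s k = run m rho gamma i (State 0 q0 p0) k.
Proof.
move=> m0 r0 g0 [s0 cs] c0; elim=> [|k [ck sk]]; first by [].
split; last by rewrite /= -sk; exact: collision_next ck.
have [j cj] := cs k.+1.
have <- // : j = side i k.+1.
apply: ord2_eq_rev; apply/eqP => jE; move: cj; rewrite jE => cj.
have := collision_speed _ _ _ _ _ _ cj; rewrite ltNge => /negP; apply.
case: ck (collision_speed _ _ _ _ _ _ ck) => _ _ _ _ -> v0.
by rewrite normal_U // mulNr -mulrN mulr_ge0 ?ltW // oppr_gt0.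
Qed.

Definition impact_speed {R : realType} (m rho gamma : R) i s k : R :=
  - normal (side i k) (vel (run m rho gamma i s k)).

Lemma rev_side i k : rev_ord (side i k.+1) = side i k.
Proof. by rewrite /= rev_ordK. Qed.

Lemma impact_speed_free {R : realType} (m rho gamma : R) i s k :
  0 < m -> 0 < rho ->
  normal (side i k) (vel (run m rho gamma i s k.+1)) =
  gamma * impact_speed m rho gamma i s k.
Proof. by move=> m0 r0; rewrite normal_U // mulrN mulNr. Qed.

Lemma impact_speedS {R : realType} (m rho gamma : R) i s k :
  0 < m -> 0 < rho ->
  impact_speed m rho gamma i s k.+1 =
  kappa rho gamma * impact_speed m rho gamma i s k
  - normal (rev_ord (side i k)) (vel (run m rho gamma i s k)).
Proof.
move=> m0 r0; rewrite {1}/impact_speed normal_rev_U //.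
by rewrite /impact_speed; ring.
Qed.

(** The endpoint not hit at collision [k.+1] is the one that rebounded at collision [k], so its
    velocity is [gamma] times the earlier impact speed. *)
Lemma impact_speed_rec {R : realType} (m rho gamma : R) i s k :
  0 < m -> 0 < rho ->
  impact_speed m rho gamma i s k.+2 =
  kappa rho gamma * impact_speed m rho gamma i s k.+1
  - gamma * impact_speed m rho gamma i s k.
Proof. by move=> m0 r0; rewrite impact_speedS // rev_side impact_speed_free. Qed.

(** After each collision the endpoint just hit is on the ground and rising, and the positive impact
    speed makes the other one descend: the situation of [next_collision]. *)
Lemma run_collisions {R : realType} (m rho gamma : R) i s :
  0 < m -> 0 < rho -> 0 < gamma ->
  collision m rho gamma s i (run m rho gamma i s 1) ->
  (forall k, 0 < impact_speed m rho gamma i s k) ->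
  forall k, collision m rho gamma (run m rho gamma i s k) (side i k)
    (run m rho gamma i s k.+1).
Proof.
move=> m0 r0 g0 c0 a0; elim=> [//|k IH].
have v0 := a0 k.+1; rewrite oppr_gt0 in v0.
case: (IH) => tau0 adm qE [[h0 _] _] vE.
apply: next_collision => //.
- by rewrite qE; apply: adm; rewrite tau0 lexx.
- by rewrite rev_side h0.
- by rewrite rev_side impact_speed_free // mulr_gt0.
Qed.

(** The index starts at the first collision: before it, neither endpoint need be on the ground. *)
Definition flight_height {R : realType} (m rho gamma : R) i s k : R :=
  normal (side i k.+1) (conf (run m rho gamma i s k.+1)).

Lemma flight_timeE {R : realType} (m rho gamma : R) i s k :
  collision m rho gamma (run m rho gamma i s k.+1) (side i k.+1)
    (run m rho gamma i s k.+2) ->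
  impact_speed m rho gamma i s k.+1 *
    (time (run m rho gamma i s k.+2) - time (run m rho gamma i s k.+1)) =
  flight_height m rho gamma i s k.
Proof.
by move/collision_normal0 => h; rewrite /impact_speed /flight_height; lra.
Qed.

Lemma flight_heightS {R : realType} (m rho gamma : R) i s k :
  0 < m -> 0 < rho ->
  collision m rho gamma (run m rho gamma i s k) (side i k)
    (run m rho gamma i s k.+1) ->
  collision m rho gamma (run m rho gamma i s k.+1) (side i k.+1)
    (run m rho gamma i s k.+2) ->
  flight_height m rho gamma i s k.+1 = gamma * impact_speed m rho gamma i s k *
    (time (run m rho gamma i s k.+2) - time (run m rho gamma i s k.+1)).
Proof.
move=> m0 r0 [_ _ _ [[h0 _] _] _] [_ _ qE _ _].
rewrite /flight_height qE normalD normalZ.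
rewrite (_ : side i k.+2 = side i k); last by rewrite /= rev_ordK.
by rewrite h0 add0r impact_speed_free // mulrC.
Qed.


(** The endpoint may change with the index, as it does along the trajectory, so the bound on the
    norm has to be uniform in the endpoint. *)
Lemma cvg_normal0 {R : realType} (p : nat -> 'cV[R]_2) (j : nat -> 'I_2) :
  (fun k => normal (j k) (p k)) @ \oo --> (0 : R) ->
  (fun k => normal (rev_ord (j k)) (p k)) @ \oo --> (0 : R) ->
  p @ \oo --> (0 : 'cV[R]_2).
Proof.
move=> c1 c2.
(* The basis dual to the two normal components. *)
pose e : 'I_2 -> 'cV[R]_2 := fun i =>
  vec2 (if i == 0 then 1 / 2 else - (1 / 2)) (1 / 2).
have pE w i : w = normal i w *: e i + normal (rev_ord i) w *: e (rev_ord i).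
  apply: normal_inj; elim/ord2_ind: i;
    rewrite ?rev_ord2_0 ?rev_ord2_1 !normalD !normalZ /e !normal_vec2 /=; lra.
pose G := `|e 0| + `|e 1|.
have eG i : `|e i| <= G.
  by elim/ord2_ind: i; rewrite /G ?lerDl ?lerDr.
apply: norm_cvg0.
apply: (@squeeze_cvgr _ _ _ _ (cst 0) (fun k => `|normal (j k) (p k)| * G +
   `|normal (rev_ord (j k)) (p k)| * G)).
- near=> k; rewrite normr_ge0 /= {1}(pE (p k) (j k)).
  by rewrite (le_trans (ler_normD _ _)) // !normrZ lerD // ler_wpM2l.
- exact: cvg_cst.
- rewrite -[0 in X in _ --> X](_ : `|0 : R| * G + `|0 : R| * G = 0).
    2: by rewrite normr0 mul0r addr0.
  by apply: cvgD; apply: cvgMl; apply: cvg_norm.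
Unshelve. all: by end_near. Qed.

(** * Characteristic roots and the bound on the radius of gyration *)

(** With [s = sqrt gamma] the discriminant condition reads [kappa >= 2 s], which rearranges to
    [(rho (1 + s))^2 <= (1 - s)^2]. *)
Lemma kappa_ge_rho {R : realType} (rho gamma : R) :
  0 < rho -> 0 < gamma < 1 ->
  0 < kappa rho gamma -> 4 * gamma <= kappa rho gamma ^+ 2 ->
  rho <= 2 / (Num.sqrt gamma + 1) - 1.
Proof.
move=> r0 /andP[g0 g1] k0 disc.
have sE : Num.sqrt gamma ^+ 2 = gamma by rewrite sqr_sqrtr // ltW.
have s0 : 0 < Num.sqrt gamma by rewrite sqrtr_gt0.
have s1 : Num.sqrt gamma < 1 by rewrite -sqrtr1 ltr_sqrt.
move: sE s0 s1; set s := Num.sqrt gamma => sE s0 s1.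
have d0 : 0 < 1 + rho ^+ 2 by rewrite ltr_wpDr ?sqr_ge0.
have kE : kappa rho gamma * (1 + rho ^+ 2) = (1 + gamma) * (1 - rho ^+ 2).
  by rewrite /kappa divfK // lt0r_neq0.
have ks : 2 * s <= kappa rho gamma.
  have s20 : 0 <= 2 * s by lra.
  rewrite -(@ler_pXn2r _ 2) ?nnegrE ?(ltW k0) // exprMn sE.
  by apply: le_trans disc; lra.
have : 2 * s * (1 + rho ^+ 2) <= (1 + gamma) * (1 - rho ^+ 2).
  by rewrite -kE ler_pM2r.
rewrite -sE => main.
have : (rho * (1 + s)) ^+ 2 <= (1 - s) ^+ 2 by nra.
rewrite ler_pXn2r ?nnegrE ?mulr_ge0 ?subr_ge0 ?addr_ge0 ?(ltW r0) ?(ltW s0) ?(ltW s1) //.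
move=> h; rewrite lerBrDr ler_pdivlMr; lra.
Qed.

(** The numbers [lam] and [mu] are the eigenvalues of [U_0 P], whose trace is [kappa] and whose
    determinant is [gamma]. *)
Lemma chatter_roots {R : realType} (rho gamma : R) :
  0 < rho -> 0 < gamma < 1 -> rho <= 2 / (Num.sqrt gamma + 1) - 1 ->
  exists lam mu, [/\ 0 < mu <= lam, lam < 1,
    kappa rho gamma = lam + mu, gamma = lam * mu &
    p_min rho gamma = vec2 ((1 + lam) / (1 - lam)) (-1)].
Proof.
move=> r0 /andP[g0 g1] hrho.
have sE : Num.sqrt gamma ^+ 2 = gamma by rewrite sqr_sqrtr // ltW.
have s0 : 0 < Num.sqrt gamma by rewrite sqrtr_gt0.
have s1 : Num.sqrt gamma < 1 by rewrite -sqrtr1 ltr_sqrt.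
move: sE s0 s1 hrho; set s := Num.sqrt gamma => sE s0 s1 hrho.
have d0 : 0 < 1 + rho ^+ 2 by rewrite ltr_wpDr ?sqr_ge0.
have dn0 := lt0r_neq0 d0.
set k := kappa rho gamma.
have kE : k * (1 + rho ^+ 2) = (1 + gamma) * (1 - rho ^+ 2).
  by rewrite /k /kappa divfK.
have hr : rho * (1 + s) <= 1 - s.
  have s10 : 0 < s + 1 by lra.
  by move: hrho; rewrite lerBrDr ler_pdivlMr //; lra.
have ks : 2 * s <= k.
  rewrite -(ler_pM2r d0) kE -sE.
  have : (rho * (1 + s)) ^+ 2 <= (1 - s) ^+ 2.
    rewrite lerXn2r ?nnegrE ?mulr_ge0 ?subr_ge0 ?addr_ge0 ?(ltW r0) ?(ltW s0) ?(ltW s1) //.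
  nra.
have k1 : k < 1 + gamma.
  rewrite -(ltr_pM2r d0) kE ltr_pM2l; last lra.
  have : 0 < rho ^+ 2 by rewrite exprn_gt0.
  lra.
have disc : 0 <= k ^+ 2 - 4 * gamma by rewrite -sE; nra.
pose del := Num.sqrt (k ^+ 2 - 4 * gamma).
have del0 : 0 <= del by rewrite sqrtr_ge0.
have delE : del ^+ 2 = k ^+ 2 - 4 * gamma by rewrite sqr_sqrtr.
have delk : del < k by rewrite -(@ltr_pXn2r _ 2) ?nnegrE //; lra.
(* Squared, this is [k < 1 + gamma]: the characteristic polynomial is positive at 1. It yields
   [lam < 1]. *)
have del2 : del < 2 - k by rewrite -(@ltr_pXn2r _ 2) ?nnegrE //; nra.
exists ((k + del) / 2), ((k - del) / 2); split.
- by apply/andP; split; lra.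
- lra.
- by field.
- have -> : gamma = (k ^+ 2 - del ^+ 2) / 4 by rewrite delE; field.
  by field.
- rewrite /p_min; congr (vec2 _ _).
  have -> : sigma rho gamma = (1 + rho ^+ 2) ^+ 2 * (k ^+ 2 - 4 * gamma).
    by rewrite /sigma /k /kappa; field.
  rewrite sqrtrM ?sqr_ge0 // sqrtr_sqr gtr0_norm // -/del.
  (* After cancelling [1 + rho ^+ 2], the denominator is [1 + gamma - k = (1 - lam) (1 - mu)] and
     the numerator is [1 - gamma + del = (1 + lam) (1 - mu)]. *)
  have rg : 2 * rho ^+ 2 * (gamma + 1) = (1 + rho ^+ 2) * (1 + gamma - k).
    by rewrite mulrBr (mulrC _ k) kE; ring.
  rewrite rg.
  have -> : ((1 - gamma) * (rho ^+ 2 + 1) + (1 + rho ^+ 2) * del) =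
    (1 + rho ^+ 2) * (1 - gamma + del) by ring.
  rewrite -mulf_div divff // mul1r.
  apply/eqP; rewrite eqr_div; last 2 first.
  + by rewrite subr_eq0 gt_eqF.
  + by rewrite subr_eq0 gt_eqF //; lra.
  apply/eqP.
  have -> : gamma = (k ^+ 2 - del ^+ 2) / 4 by rewrite delE; field.
  by field.
Qed.

(** * The cone in terms of normal velocities *)

Lemma cone1E {R : realType} (u p : 'cV[R]_2) :
  cone [:: u] p <-> exists a, 0 <= a /\ p = a *: u.
Proof.
split=> [[c [c0 ->]]|[a [a0 ->]]].
  by exists (c ord0); rewrite big_ord_recl big_ord0 addr0.
by exists (fun=> a); rewrite big_ord_recl big_ord0 addr0.
Qed.

Lemma cone2E {R : realType} (u w p : 'cV[R]_2) :
  cone [:: u; w] p <-> exists a b, [/\ 0 <= a, 0 <= b & p = a *: u + b *: w].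
Proof.
split=> [[c [c0 ->]]|[a [b [a0 b0 ->]]]].
  exists (c ord0), (c (lift ord0 ord0)); split=> //.
  by rewrite !big_ord_recl big_ord0 addr0.
exists (fun i => if i == ord0 then a else b); split.
  by move=> i; case: ifP.
by rewrite !big_ord_recl big_ord0 addr0.
Qed.

(** In normal components the generators are [n (lam, -1)] and [n (-1, lam)]. As [normal i p] is
    negative, the coefficient of [w] is positive once that of [u] is nonnegative, so the latter
    alone decides; it vanishes on the edge. *)
Lemma cone_normal {R : realType} (lam n : R) i (u w p : 'cV[R]_2) :
  0 < lam < 1 -> 0 < n ->
  normal i u = lam * n -> normal (rev_ord i) u = - n ->
  normal i w = - n -> normal (rev_ord i) w = lam * n ->
  normal i p < 0 ->
  (cone [:: u; w] p <-> normal (rev_ord i) p <= lam * - normal i p) /\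
  (cone [:: u] p \/ cone [:: w] p <->
    normal (rev_ord i) p = lam * - normal i p).
Proof.
move=> /andP[lam0 lam1] n0 ui uj wi wj pi.
have ln0 : 0 < lam * n by rewrite mulr_gt0.
have l20 : 0 < 1 - lam ^+ 2 by rewrite subr_gt0 expr_lt1 // ltW.
set a := - normal i p; have a0 : 0 < a by rewrite oppr_gt0.
(* Solution of the two linear equations for the coefficients of [u] and [w]. *)
pose x := (lam * a - normal (rev_ord i) p) / (n * (1 - lam ^+ 2)).
pose y := a / n + lam * x.
have pE : p = x *: u + y *: w.
  apply: (normal_inj_rev i); rewrite !normalD !normalZ !(ui, uj, wi, wj) /y /x /a.
    by field; rewrite !lt0r_neq0.
  by field; rewrite !lt0r_neq0.
split; split.
- move=> /cone2E[c [d [c0 d0 pcd]]]; rewrite /a pcd !normalD !normalZ ui uj wi wj.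
  by have := mulr_ge0 (mulr_ge0 c0 (ltW n0)) (ltW l20); lra.
- move=> le_p; apply/cone2E; exists x, y.
  have x0 : 0 <= x by rewrite divr_ge0 ?subr_ge0 // mulr_ge0 // ltW.
  split=> //; apply: addr_ge0; first by rewrite divr_ge0 // ltW.
  by rewrite mulr_ge0 // ltW.
- move=> [/cone1E[c [c0 pc]]|/cone1E[c [c0 pc]]].
    (* No multiple of [u] in its cone moves endpoint [i] downwards, so only the edge along [w]
       remains. *)
    move: pi; rewrite pc normalZ ui ltNge.
    by rewrite mulr_ge0 // ltW.
  by rewrite /a pc !normalZ wi wj; ring.
- move=> eq_p; right; apply/cone1E; exists (a / n); split.
    by rewrite divr_ge0 // ltW.
  by rewrite {1}pE /y /x eq_p subrr mul0r scale0r add0r mulr0 addr0.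
Qed.

(** The criterion has the same form for both endpoints because [P] exchanges their normal
    velocities, and with them the two generators. *)
Lemma K_normal {R : realType} (rho gamma lam : R) i p :
  0 < lam < 1 -> p_min rho gamma = vec2 ((1 + lam) / (1 - lam)) (-1) ->
  normal i p < 0 ->
  (K rho gamma p <-> normal (rev_ord i) p <= lam * - normal i p) /\
  (K_edges rho gamma p <-> normal (rev_ord i) p = lam * - normal i p).
Proof.
move=> lam01 pE pi; have /andP[lam0 lam1] := lam01.
have l1 : 1 - lam != 0 by rewrite subr_eq0 gt_eqF.
set u := p_min rho gamma; set w := P R *m u.
have n0 : 0 < 2 / (1 - lam) by rewrite divr_gt0 // subr_gt0.
have u0 : normal 0 u = lam * (2 / (1 - lam)).
  by rewrite /u pE normal_vec2 /=; field.
have u1 : normal 1 u = - (2 / (1 - lam)).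
  by rewrite /u pE normal_vec2 /=; field.
have w0 : normal 0 w = - (2 / (1 - lam)) by rewrite normal_P rev_ord2_0.
have w1 : normal 1 w = lam * (2 / (1 - lam)) by rewrite normal_P rev_ord2_1.
elim/ord2_ind: i pi => pi.
  by apply: (cone_normal _ _ _ _ _ _ lam01 n0); rewrite ?rev_ord2_0.
have [h1 h2] : (cone [:: w; u] p <-> normal (rev_ord 1) p <= lam * - normal 1 p) /\
  (cone [:: w] p \/ cone [:: u] p <-> normal (rev_ord 1) p = lam * - normal 1 p).
  by apply: (cone_normal _ _ _ _ _ _ lam01 n0); rewrite ?rev_ord2_1.
split.
- rewrite -h1 /K -/u -/w !cone2E.
  by split=> -[a [b [a0 b0 ->]]]; exists b, a; rewrite addrC.
- by rewrite -h2; split=> -[]; [right|left|right|left].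
Qed.


(** * Existence, decay and duration of infinite collision sequences *)

Lemma first_collision_run {R : realType} (m rho gamma : R) q0 p0 :
  before_first_collision m rho gamma q0 p0 ->
  exists i, 0 < time (run m rho gamma i (State 0 q0 p0) 1) /\
    collision m rho gamma (State 0 q0 p0) i
      (run m rho gamma i (State 0 q0 p0) 1).
Proof.
move=> [i [s1 [t1 c1]]]; exists i.
by rewrite -[run _ _ _ _ _ 1](collision_next _ _ _ _ _ _ c1).
Qed.

Lemma collision_sequence_uniq {R : realType} (m rho gamma : R) q0 p0 i s :
  0 < m -> 0 < rho -> 0 < gamma ->
  let r := run m rho gamma i (State 0 q0 p0) in
  collision m rho gamma (r 0%N) i (r 1%N) ->
  collision_sequence m rho gamma q0 p0 s ->
  s = r /\ forall k, collision m rho gamma (r k) (side i k) (r k.+1).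
Proof.
move=> m0 r0 g0 r c1 cs; have [s0 sk] := cs.
have [j cj] := sk 0%N; rewrite s0 in cj.
have ji : j = i := collision_uniq _ _ _ _ _ _ _ _ cj c1.
have c0 : collision m rho gamma (s 0%N) i (s 1%N) by rewrite s0 -ji.
have sr := collision_sequence_run _ _ _ _ _ _ _ m0 r0 g0 cs c0.
have srE : s = r by apply/funext => k; have [] := sr k.
by split=> // k; rewrite -srE; have [] := sr k.
Qed.

(** As [kappa = lam + mu], the gap [a 1 - mu * a 0] equals [lam * - normal i p0 - normal (rev_ord i)
    p0], whose sign [K_normal] translates into membership in the cone. *)
Lemma collisions_forever {R : realType} (m rho gamma : R) q0 p0 i :
  0 < m -> 0 < rho -> 0 < gamma < 1 -> normal i p0 < 0 ->
  (forall k, 0 < impact_speed m rho gamma i (State 0 q0 p0) k) <->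
  rho <= 2 / (Num.sqrt gamma + 1) - 1 /\ K rho gamma p0.
Proof.
move=> m0 r0 g01 p0i; have /andP[g0 g1] := g01.
set a := impact_speed _ _ _ _ _.
have rec k : a k.+2 = kappa rho gamma * a k.+1 - gamma * a k.
  exact: impact_speed_rec.
have a1E : a 1%N = kappa rho gamma * - normal i p0 - normal (rev_ord i) p0.
  exact: impact_speedS.
have a0E : a 0%N = - normal i p0 by [].
split=> [a0|[hrho]].
  have [k0 disc] := rec2_pos_discr _ _ _ g0 rec a0.
  have hrho := kappa_ge_rho _ _ r0 g01 k0 disc.
  split=> //.
  have [lam [mu [mulam lam1 kE gE pE]]] := chatter_roots _ _ r0 g01 hrho.
  have lam01 : 0 < lam < 1 by case/andP: mulam => ? ?; apply/andP; split; lra.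
  apply/(K_normal _ _ _ _ _ lam01 pE p0i).1.
  have := rec2_pos_gap_ge0 lam mu a mulam _ a0; rewrite -kE -gE => /(_ rec).
  by rewrite a1E a0E kE; lra.
have [lam [mu [mulam lam1 kE gE pE]]] := chatter_roots _ _ r0 g01 hrho.
have [lam0 mu0] : 0 < lam /\ 0 < mu by case/andP: mulam => ? ?; split; lra.
have lam01 : 0 < lam < 1 by rewrite lam0.
move/(K_normal _ _ _ _ _ lam01 pE p0i).1 => le_p.
apply: (rec2_pos lam mu) => //; rewrite -?kE -?gE //.
- by rewrite a0E oppr_gt0.
- by rewrite a1E a0E kE; lra.
Qed.

Lemma run_vanishing {R : realType} (m rho gamma lam mu : R) i s :
  0 < m -> 0 < rho -> 0 < lam < 1 -> 0 < mu <= lam ->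
  kappa rho gamma = lam + mu -> gamma = lam * mu ->
  vanishing_velocity (run m rho gamma i s).
Proof.
move=> m0 r0 lam01 mulam kE gE.
set a := impact_speed m rho gamma i s.
have a0 : a @ \oo --> (0 : R).
  apply: (rec2_cvg0 lam mu) => // k; rewrite -kE -gE.
  exact: impact_speed_rec.
(* Just after collision [k] the normal velocities are [gamma * a k] at the endpoint hit and
   [- a k.+1] at the other; the initial state is skipped. *)
rewrite /vanishing_velocity -cvg_shiftS.
apply: (cvg_normal0 _ (fun k => side i k)).
  have -> : (fun k => normal (side i k) (vel (run m rho gamma i s k.+1))) =
      (fun k => gamma * a k).
    by apply/funext => k; exact: impact_speed_free.
  by rewrite -[0](mulr0 gamma); apply: cvgMr.
have -> : (fun k => normal (rev_ord (side i k)) (vel (run m rho gamma i s k.+1))) =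
    (fun k => - a k.+1).
  by apply/funext => k; rewrite /a /impact_speed opprK.
by rewrite -[0]oppr0; apply: cvgN; rewrite (cvg_shiftS a).
Qed.

Lemma run_time_bounded {R : realType} (m rho gamma lam mu : R) q0 p0 i :
  0 < m -> 0 < rho -> 0 < mu <= lam ->
  kappa rho gamma = lam + mu -> gamma = lam * mu ->
  let r := run m rho gamma i (State 0 q0 p0) in
  0 < time (r 1%N) ->
  (forall k, collision m rho gamma (r k) (side i k) (r k.+1)) ->
  (exists T, forall k, time (r k) <= T) <->
  normal (rev_ord i) p0 <> lam * - normal i p0.
Proof.
move=> m0 r0 mulam kE gE r t1 cr; have /andP[mu0 le_mulam] := mulam.
set a := impact_speed m rho gamma i (State 0 q0 p0).
set h := flight_height m rho gamma i (State 0 q0 p0).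
pose t k := time (r k.+1).
have a0 k : 0 < a k.
  by have := collision_speed _ _ _ _ _ _ (cr k); rewrite /a oppr_gt0.
have rec k : a k.+2 = (lam + mu) * a k.+1 - lam * mu * a k.
  by rewrite -kE -gE; exact: impact_speed_rec.
have th k : a k.+1 * (t k.+1 - t k) = h k by exact: flight_timeE.
have hS k : h k.+1 = lam * mu * a k * (t k.+1 - t k).
  by rewrite -gE; exact: flight_heightS.
have a0E : a 0%N = - normal i p0 by [].
have a1E : a 1%N = mu * a 0%N + (lam * - normal i p0 - normal (rev_ord i) p0).
  rewrite a0E; have -> : a 1%N = kappa rho gamma * - normal i p0
    - normal (rev_ord i) p0 by exact: impact_speedS.
  by rewrite kE; ring.
have adm u : 0 <= u <= t 0%N - 0 -> admissible (q0 + u *: p0).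
  by case: (cr 0%N) => _ /(_ u).
rewrite subr0 in adm.
have q1E : conf (r 1%N) = q0 + (t 0%N - 0) *: p0 by case: (cr 0%N).
have h0E : h 0%N = normal (rev_ord i) q0 + t 0%N * normal (rev_ord i) p0.
  by rewrite -[h 0%N]/(normal _ (conf (r 1%N))) q1E subr0 normalD normalZ.
split=> [tb p0E|].
  have a1 : a 1%N = mu * a 0%N by rewrite a1E p0E; ring.
  (* On the edge the free endpoint rises during the initial flight, which has positive duration, so
     it is strictly above the ground at the first collision. *)
  have h0 : 0 < h 0%N.
    rewrite h0E p0E -a0E ltr_wpDl //; last by rewrite !mulr_gt0 // (lt_le_trans mu0).
    by have := adm 0; rewrite scale0r addr0; apply; rewrite lexx /= ltW.
  apply: (flight_times_unbounded lam mu a h t) => //.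
  by have [T tT] := tb; exists T => k; exact: tT.
move=> /eqP ne; have a1 : mu * a 0%N < a 1%N.
  rewrite lt_neqAle (rec2_pos_gap_ge0 lam) // andbT.
  by apply: contra_neq ne => a01; lra.
have h0 : 0 <= h 0%N.
  rewrite h0E -normalZ -normalD; apply: adm.
  by rewrite lexx ltW.
have bound := flight_times_bounded lam mu a h t mu0 a0 rec th hS h0 a1.
(* The initial state is not covered by [t]; it precedes the first collision. *)
exists (t 0%N + h 0%N / (a 1%N - mu * a 0%N)) => -[|k]; last exact: bound.
by apply: (le_trans _ (bound 0%N)); rewrite ltW.
Qed.

Theorem theorem3 (R : realType) (m rho gamma : R) (q0 p0 : 'cV[R]_2)
    (hm : 0 < m) (hrho : 0 < rho) (hgamma : 0 < gamma < 1)
    (hfirst : before_first_collision m rho gamma q0 p0) :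
  (complete_chatter m rho gamma q0 p0 <->
     rho <= 2 / (Num.sqrt gamma + 1) - 1 /\
     (K rho gamma `\` K_edges rho gamma) p0) /\
  (endless_chatter m rho gamma q0 p0 <->
     rho <= 2 / (Num.sqrt gamma + 1) - 1 /\ K rho gamma p0).
Proof.
have g0 : 0 < gamma by case/andP: hgamma.
have [i [t1 c1]] := first_collision_run _ _ _ _ _ hfirst.
set r := run m rho gamma i (State 0 q0 p0) in t1 c1.
have p0i : normal i p0 < 0 := collision_speed _ _ _ _ _ _ c1.
have forever := collisions_forever m rho gamma q0 p0 i hm hrho hgamma p0i.
have uniq s : collision_sequence m rho gamma q0 p0 s -> s = r /\
    forall k, collision m rho gamma (r k) (side i k) (r k.+1).
  exact: collision_sequence_uniq.
have forward : (forall k, collision m rho gamma (r k) (side i k) (r k.+1)) ->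
    rho <= 2 / (Num.sqrt gamma + 1) - 1 /\ K rho gamma p0.
  move=> cr; apply/forever => k.
  by have := collision_speed _ _ _ _ _ _ (cr k); rewrite oppr_gt0.
have backward : rho <= 2 / (Num.sqrt gamma + 1) - 1 -> K rho gamma p0 ->
    forall k, collision m rho gamma (r k) (side i k) (r k.+1).
  by move=> h1 h2; apply: run_collisions => //; exact/forever.
have roots : rho <= 2 / (Num.sqrt gamma + 1) - 1 ->
    (forall k, collision m rho gamma (r k) (side i k) (r k.+1)) ->
    vanishing_velocity r /\
    ((exists T, forall k, time (r k) <= T) <-> ~ K_edges rho gamma p0).
  move=> h1 cr.
  have [lam [mu [mulam lam1 kE gE pE]]] := chatter_roots _ _ hrho hgamma h1.
  have lam01 : 0 < lam < 1 by case/andP: mulam => ? ?; apply/andP; split; lra.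
  split; first exact: (run_vanishing _ _ _ lam mu).
  have [_ ->] := K_normal _ _ _ _ _ lam01 pE p0i.
  exact: (run_time_bounded _ _ _ lam mu).
have r_seq : (forall k, collision m rho gamma (r k) (side i k) (r k.+1)) ->
    collision_sequence m rho gamma q0 p0 r.
  by move=> cr; split=> // k; exists (side i k).
split; split.
- move=> [s [/uniq[-> cr] tb _]]; have [h1 hK] := forward cr.
  by split=> //; split=> //; apply/(roots h1 cr).2.
- move=> [h1 [hK hE]]; have cr := backward h1 hK.
  exists r; split; [exact: r_seq | exact/(roots h1 cr).2 | exact: (roots h1 cr).1].
- by move=> [s [/uniq[_ cr] _]]; exact: forward.
- move=> [h1 hK]; have cr := backward h1 hK.
  by exists r; split; [exact: r_seq | exact: (roots h1 cr).1].
Qed.
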